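(* Fix a positive integer $d$ and a real number $\epsilon\in(0,1)$. For each positive integer $h$, let $M=M(h)$ be an integer with $2\leq M$ and $M(h)=o(h/\log h)$, and set $r^*=r^*(h):=\sqrt{d}/(2h)$. Let $r=r(h)>0$ and consider the random geometric graph sequence $\widehat{\mathcal{G}}(r,d)=(G_n)_{n\geq 1}$. Let $\mathcal{E}_h$ be the event that every balanced $M$-tree $T$ of height $h$ appears as a subgraph of $G_{|T|}$, and let $\mathcal{F}_h$ be the event that for every balanced $M$-tree $T$ of height $h$, the graph $G_{|T|}$ does not contain $T$ as a subgraph. Then: (i) if $r\leq(1-\epsilon)r^*$, then $\mathbb{P}[\mathcal{F}_h]\to 1$ as $h\to\infty$; (ii) if $r\geq(1+\epsilon)r^*$, then $\mathbb{P}[\mathcal{E}_h]\to 1$ as $h\to\infty$.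
   Context: For a finite set $\mathcal{X}\subseteq[0,1]^d$, the geometric graph $G(\mathcal{X},r,d)$ has vertex set $\mathcal{X}$ and edges $xy$ for distinct $x,y\in\mathcal{X}$ with Euclidean distance $\lVert x-y\rVert\leq r$. Let $(X_i)_{i\geq1}$ be independent uniform random points in $[0,1]^d$; the random geometric graph sequence is $\widehat{\mathcal{G}}(r,d)=(G_n)_{n\geq1}$ with $G_n=G(\{X_1,\dots,X_n\},r,d)$. $|T|$ denotes the number of vertices of $T$. For a rooted tree, the layer $V_i$ is the set of vertices at graph distance $i$ from the root, the height is the largest $h$ with $V_h$ nonempty, and the children of a vertex in $V_j$ are its neighbours in $V_{j+1}$. Given positive integers $h$ and $(s_i)_{i=1}^h$, the balanced tree over $(s_i)_{i=1}^h$ is the rooted tree of height $h$ in which, for each $i\in\{1,\dots,h\}$, every vertex of $V_{i-1}$ has exactly $s_i$ children. A balanced $M$-tree of height $h$ is a balanced tree over a sequence $(s_i)_{i=1}^h$ with $s_i\in\{2,\dots,M\}$ for all $i$. *)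

(* Defs.v *)
From HB Require Import structures.
From mathcomp Require Import all_boot all_order all_algebra.
From mathcomp Require Import all_classical all_reals all_analysis.
Set Implicit Arguments. Unset Strict Implicit. Unset Printing Implicit Defensive.
Import Order.TTheory GRing.Theory Num.Theory.
Import numFieldNormedType.Exports.
Local Open Scope classical_set_scope.
Local Open Scope ring_scope.

(* Random points: X_i = (U i k)_{k < d}, i = 0,1,2,... (X_{i+1} in the paper
   is the point with index i here).  "X_i independent uniform on [0,1]^d" is
   encoded as: the coordinates U i k (over all i and k) are mutually
   independent and each uniform on [0,1]; mutual independence is the product
   rule over every finite subfamily and every family of Borel sets. *)
Definition iid_uniform_points (R : realType) (d : nat) (dT : measure_display)
  (T : measurableType dT) (P : probability T R) (U : nat -> 'I_d -> T -> R) : Prop :=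
  (forall i k, measurable_fun setT (U i k)) /\
  forall (S : seq (nat * 'I_d)) (B : nat * 'I_d -> set R),
    uniq S -> (forall j, j \in S -> measurable (B j)) ->
    P (\bigcap_(j in [set` S]) (U j.1 j.2 @^-1` B j)) =
    (\prod_(j <- S) (@lebesgue_measure R) (B j `&` `[0%R, 1%R]))%E.

Definition edist (R : realType) (d : nat) (x y : 'I_d -> R) : R :=
  Num.sqrt (\sum_(k < d) (x k - y k) ^+ 2).

(* The balanced tree over s = (s_1,...,s_h): vertices are the sequences
   (a_1,...,a_k), 0 <= k <= h, with a_i < s_i; the root is [::], and the
   children of a are the sequences rcons a c. *)
Definition bt_vertex (s : seq nat) (a : seq nat) : bool :=
  (size a <= size s)%N && all (fun i => nth 0%N a i < nth 0%N s i)%N (iota 0 (size a)).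

Definition bt_size (s : seq nat) : nat :=
  (\sum_(k < (size s).+1) \prod_(i < k) nth 0%N s i)%N.

Definition balanced_M_seq (M h : nat) (s : seq nat) : bool :=
  (size s == h) && all (fun x => 2 <= x <= M)%N s.

Definition pt (R : realType) (d : nat) (T : Type) (U : nat -> 'I_d -> T -> R)
  (i : nat) (w : T) : 'I_d -> R := fun k => U i k w.

(* G_n(w) = G({X_1,...,X_n}, r, d) contains (a copy of) the balanced tree over s:
   there is an injective map of the tree's vertices into the vertex set
   {X_1,...,X_n} (distinct vertices go to distinct points) mapping tree edges
   to pairs of points at distance <= r. *)
Definition contains_bt (R : realType) (d : nat) (T : Type)
  (U : nat -> 'I_d -> T -> R) (r : R) (n : nat) (s : seq nat) (w : T) : Prop :=
  exists phi : seq nat -> nat,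
    [/\ (forall a, bt_vertex s a -> (phi a < n)%N),
        (forall a b, bt_vertex s a -> bt_vertex s b -> a <> b ->
           pt U (phi a) w <> pt U (phi b) w) &
        (forall a c, bt_vertex s (rcons a c) ->
           edist (pt U (phi a) w) (pt U (phi (rcons a c)) w) <= r)].

Definition event_E (R : realType) (d : nat) (T : Type)
  (U : nat -> 'I_d -> T -> R) (r : R) (M h : nat) : set T :=
  [set w | forall s, balanced_M_seq M h s -> contains_bt U r (bt_size s) s w].

Definition event_F (R : realType) (d : nat) (T : Type)
  (U : nat -> 'I_d -> T -> R) (r : R) (M h : nat) : set T :=
  [set w | forall s, balanced_M_seq M h s -> ~ contains_bt U r (bt_size s) s w].

(* Main.v *)
(** Part (i): every edge changes the sum of the coordinates by at most
    [sqrt d * r], so in a copy of [T] all points have coordinate sums within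
    [2 h sqrt d r <= (1 - eps) d] of each other.  A copy of [T] in [G_{|T|}] uses
    all of the first [2 ^ h] points, and among those some lie near the two
    opposite corners [0] and [(1, ..., 1)], whose coordinate sums differ by [d].

    Part (ii): put a grid with polynomially (in [h]) many cells on the cube, with
    a retraction [p] towards the central cell such that adjacent points (in [Q]
    and in [p Q]) are at distance at most [r] and [L < h] iterations of [p] reach
    the centre.  With high probability every long enough block of consecutive
    indices meets every cell, so that cell [Q] contains [N Q >= n / poly(h)] of the
    first [n] points.  To map [T] onto the cells with exactly [N Q] vertices in [Q],
    keep levels [< k] at the centre, assign a target cell to each vertex of
    level [k], let its descendants follow the retraction backwards to the target
    and stay there.  Choosing slightly too many vertices for each non-central
    target leaves in each cell a small excess, which is pushed towards the centre
    by moving leaves from [Q] to [p Q].  Vertices at levels [< k + L] are at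
    most a [2 ^ - k] fraction of [T], hence negligible against [N Q]. *)
Require Import Defs.
From HB Require Import structures.
From mathcomp Require Import all_boot all_order all_algebra.
From mathcomp Require Import all_classical all_reals all_analysis.
From mathcomp Require Import measurable_realfun.
From mathcomp Require Import ring lra zify.
Set Implicit Arguments. Unset Strict Implicit. Unset Printing Implicit Defensive.
Import Order.TTheory GRing.Theory Num.Theory.
Import numFieldNormedType.Exports.

(** * Trees and their maps to a cell graph *)

Fixpoint bt_level (s : seq nat) (k : nat) : seq (seq nat) :=
  if k is k'.+1 then [seq rcons a c | a <- bt_level s k', c <- iota 0 (nth 0 s k')]
  else [:: [::]].

Definition bt_vertices (s : seq nat) : seq (seq nat) :=
  flatten [seq bt_level s k | k <- iota 0 (size s).+1].

Lemma mem_bt_level s k a :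
  (a \in bt_level s k) =
  (size a == k) && all (fun i => nth 0 a i < nth 0 s i) (iota 0 k).
Proof.
elim: k a => [|k IH] a; first by case: a.
rewrite -addn1 iotaD all_cat /= add0n andbT addn1.
apply/allpairsPdep/idP => [[b [c [bk cs ->]]]|].
  move: bk; rewrite IH => /andP[/eqP sb /allP bs].
  rewrite size_rcons sb eqxx /= nth_rcons sb ltnn eqxx.
  move: cs; rewrite mem_iota /= add0n => ->; rewrite andbT.
  apply/allP => i; rewrite mem_iota => /= ik.
  by rewrite nth_rcons sb ik; apply: bs; rewrite mem_iota.
case/lastP: a => [|b c] //; rewrite size_rcons eqSS => /andP[/eqP sb].
rewrite nth_rcons sb ltnn eqxx => /andP[/allP bs cs].
exists b, c; split => //; last by rewrite mem_iota.
rewrite IH sb eqxx; apply/allP => i; rewrite mem_iota => /= ik.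
by have := bs i; rewrite mem_iota nth_rcons sb ik => /(_ isT).
Qed.

Lemma size_bt_level_mem s k a : a \in bt_level s k -> size a = k.
Proof. by rewrite mem_bt_level => /andP[/eqP]. Qed.

Lemma bt_level_uniq s k : uniq (bt_level s k).
Proof.
elim: k => [|k IH] //=; apply: allpairs_uniq => //; first exact: iota_uniq.
by move=> [a c] [b e] _ _ /= /rcons_inj[-> ->].
Qed.

(** All vertices of level [k] have equally many descendants in level [j], and [take k] recovers the
    ancestor. Counts of targets at level [k] thus scale to counts at deeper levels. *)
Lemma count_bt_level (P : pred (seq nat)) s k j : k <= j ->
  count (fun a => P (take k a)) (bt_level s j) =
  count P (bt_level s k) * \prod_(k <= i < j) nth 0 s i.
Proof.
elim: j => [|j IH]; rewrite ?leqn0.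
  by move=> /eqP ->; rewrite big_geq // muln1; apply: eq_in_count => a /size_bt_level_mem /size0nil ->.
rewrite leq_eqVlt => /orP[/eqP <-|kj].
  rewrite big_geq // muln1; apply: eq_in_count => a /size_bt_level_mem.
  by move=> sa; rewrite take_oversize // sa.
rewrite big_nat_recr //= mulnA -IH //.
rewrite count_flatten -map_comp.
transitivity (sumn [seq nth 0 s j * P (take k a) | a <- bt_level s j]).
  congr sumn; apply/eq_in_map => a /size_bt_level_mem sa /=.
  rewrite count_map (eq_count (a2 := fun _ => P (take k a))); last first.
    by move=> c /=; rewrite -cats1 takel_cat // sa.
  case: (P _); last by rewrite count_pred0 muln0.
  by rewrite count_predT size_iota muln1.
elim: (bt_level s j) => //= a l ->; lia.
Qed.

Lemma size_bt_level s k : size (bt_level s k) = \prod_(i < k) nth 0 s i.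
Proof.
rewrite -count_predT (@count_bt_level predT s 0 k) //=.
by rewrite /predT /= mul1n big_mkord.
Qed.

Lemma count_bt_vertices P s :
  count P (bt_vertices s) = \sum_(k < (size s).+1) count P (bt_level s k).
Proof.
rewrite count_flatten -map_comp sumnE big_map -(subn0 (size s).+1) -/(index_iota 0 _).
by rewrite subn0 big_mkord.
Qed.

Lemma size_bt_vertices s : size (bt_vertices s) = bt_size s.
Proof.
rewrite -count_predT count_bt_vertices; apply: eq_bigr => k _.
by rewrite count_predT size_bt_level.
Qed.

Lemma mem_bt_vertices s a : (a \in bt_vertices s) = bt_vertex s a.
Proof.
apply/flatten_mapP/idP => [[k]|/andP[sa H]].
  rewrite mem_iota /= ltnS => ks; rewrite mem_bt_level => /andP[/eqP sa].
  by rewrite /bt_vertex sa ks.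
exists (size a); first by rewrite mem_iota /= ltnS.
by rewrite mem_bt_level eqxx.
Qed.

Lemma bt_vertices_uniq s : uniq (bt_vertices s).
Proof.
rewrite /bt_vertices; elim: (size s).+1 => [|n IH] //.
rewrite -addn1 iotaD map_cat flatten_cat cat_uniq IH /= cats0 bt_level_uniq andbT.
apply/hasPn => a /size_bt_level_mem sa; apply/negP => /flatten_mapP[k].
by rewrite mem_iota => /andP[_ kn] /size_bt_level_mem; rewrite sa; lia.
Qed.

Lemma count_mem_take (T : eqType) (t : seq T) x : uniq t -> x <= size t ->
  count (fun a => a \in take x t) t = x.
Proof.
move=> ut xt; rewrite -[in LHS](cat_take_drop x t) count_cat cat_take_drop.
have -> : count (fun a => a \in take x t) (take x t) = x.
  rewrite (eq_in_count (a2 := predT)) ?count_predT ?size_takel //.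
rewrite (eq_in_count (a2 := pred0)) ?count_pred0 ?addn0 // => a ad /=.
move: ut; rewrite -{1}(cat_take_drop x t) cat_uniq => /and3P[_ /hasPn H _].
by apply/negbTE/H.
Qed.

Lemma count_partition (T : Type) (C : finType) (g : T -> C) (P : pred T) (s : seq T) :
  count P s = \sum_(j : C) count (fun a => P a && (g a == j)) s.
Proof.
elim: s => [|a s IH] /=; first by rewrite big1.
rewrite big_split /= -IH; congr (_ + _).
rewrite (bigD1 (g a)) //= eqxx andbT big1 ?addn0 // => j /negbTE.
by rewrite eq_sym => ->; rewrite andbF.
Qed.

(** In each class the first [x Q] members are moved along [p]. The additive form avoids truncated
    subtraction and stays valid at fixed points of [p]. *)
Lemma shift_counts (T : eqType) (C : finType) (p : C -> C) (g : T -> C)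
    (s : seq T) (x : C -> nat) : uniq s ->
  (forall Q, x Q <= count (fun a => g a == Q) s) ->
  exists f : T -> C, (forall a, f a = g a \/ f a = p (g a)) /\
   forall Q, count (fun a => f a == Q) s + x Q =
     count (fun a => g a == Q) s + \sum_(j | p j == Q) x j.
Proof.
move=> us xs; pose grp Q := [seq a <- s | g a == Q].
pose f a := if a \in take (x (g a)) (grp (g a)) then p (g a) else g a.
exists f; split=> [a|Q]; first by rewrite /f; case: ifP; auto.
have cnt j : count (fun a => (f a == Q) && (g a == j)) s =
   (p j == Q) * x j + (j == Q) * (count (fun a => g a == j) s - x j).
  rewrite -[LHS](count_filter (fun a => f a == Q) (fun a => g a == j)) -/(grp j).
  have szj : count (fun a => g a == j) s = size (grp j) by rewrite size_filter.
  have ug : uniq (grp j) by exact: filter_uniq.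
  have xj : x j <= size (grp j) by rewrite -szj.
  pose inl a := a \in take (x j) (grp j).
  have -> : count (fun a => f a == Q) (grp j) =
     count (fun a => (inl a && (p j == Q)) || (~~ inl a && (j == Q))) (grp j).
    apply: eq_in_count => a; rewrite mem_filter => /andP[/eqP ga _] /=.
    by rewrite /f ga /inl; case: ifP => _ /=; rewrite ?orbF.
  have c1 : count inl (grp j) = x j by exact: count_mem_take.
  have c2 : count (predC inl) (grp j) = size (grp j) - x j.
    by rewrite -(count_predC inl (grp j)) c1 addKn.
  case: (p j == Q) (j == Q) => [] [];
    rewrite ?mul1n ?mul0n ?addn0 ?add0n ?szj.
  - rewrite subnKC // -[RHS]count_predT; apply: eq_count => a /=.
    by rewrite !andbT orbN.
  - by rewrite -c1; apply: eq_count => a /=; rewrite andbT andbF orbF.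
  - by rewrite -c2; apply: eq_count => a /=; rewrite andbT andbF.
  - by rewrite -[RHS](count_pred0 (grp j)); apply: eq_count => a /=; rewrite !andbF.
rewrite (count_partition g) (eq_bigr _ (fun j _ => cnt j)) big_split /=.
rewrite [X in _ + X + _](bigD1 Q) //= eqxx mul1n [X in _ + (_ + X) + _]big1 ?addn0; last first.
  by move=> j /negbTE ->.
rewrite -addnA subnK // addnC [in RHS]big_mkcond /=; congr (_ + _).
by apply: eq_bigr => j _; case: (p j == Q); rewrite ?mul1n.
Qed.

Lemma sum_doubling (F : nat -> nat) m n : m <= n ->
  (forall j, m <= j < n -> 2 * F j <= F j.+1) -> \sum_(m <= j < n) F j <= F n.
Proof.
elim: n => [|n IH] mn F2; first by rewrite big_geq.
move: mn; rewrite leq_eqVlt => /orP[/eqP ->|mn]; first by rewrite big_geq.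
rewrite big_nat_recr //=; have := F2 n; rewrite ltnSn andbT -ltnS mn => /(_ isT).
suff : \sum_(m <= j < n) F j <= F n by lia.
by apply: IH => // j /andP[mj jn]; apply: F2; rewrite mj ltnW.
Qed.

Lemma exp2_doubling (F : nat -> nat) m n :
  (forall j, m <= j < m + n -> 2 * F j <= F j.+1) -> 2 ^ n * F m <= F (m + n).
Proof.
elim: n => [|n IH] F2; first by rewrite addn0 mul1n.
have := F2 (m + n); rewrite leq_addr addnS ltnSn => /(_ isT).
suff : 2 ^ n * F m <= F (m + n) by rewrite expnS; lia.
by apply: IH => // j /andP[mj jn]; apply: F2; rewrite mj addnS ltnW.
Qed.

Lemma iter_fixed (T : Type) (p : T -> T) x n : p x = x -> iter n p x = x.
Proof. by move=> px; elim: n => //= n ->. Qed.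

(* [x Q] is the number of leaves to move from [Q] to [p Q] when [e] is the excess:
   the sum of the excesses over all cells whose path to the centre meets [Q]. *)
Lemma push_counts (C : finType) (p : C -> C) c0 L (e : C -> nat) :
  p c0 = c0 -> (forall Q, iter L p Q = c0) -> exists x : C -> nat,
  [/\ x c0 = 0, forall Q, x Q <= L * \sum_j e j &
    forall Q, Q != c0 -> x Q = e Q + \sum_(j | p j == Q) x j].
Proof.
move=> pc0 pL.
(* [y t Q] is the excess that reaches [Q] after exactly [t] steps. Away from [c0] it vanishes at
   [t = L], so shifting the index in the sum over [t < L] gives the recursion. *)
pose y t Q := \sum_(j | iter t p j == Q) e j.
exists (fun Q => if Q == c0 then 0 else \sum_(t < L) y t Q); split.
- by rewrite eqxx.
- move=> Q; case: eqP => // _; rewrite -[L in L * _]card_ord -sum_nat_const.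
  by apply: leq_sum => t _; rewrite /y big_mkcond; apply: leq_sum => j _; case: ifP.
move=> Q Q0; rewrite (negbTE Q0).
(* The fixed point [c0] is never sent to [Q != c0], so setting [x c0 = 0] loses nothing here. *)
have step t : \sum_(j | p j == Q) (if j == c0 then 0 else y t j) = y t.+1 Q.
  rewrite /y /= [RHS](partition_big (iter t p) (fun j => p j == Q)) //=.
  apply: eq_bigr => j pj; case: eqP => [jc0|_].
    by move: pj Q0; rewrite jc0 pc0 eq_sym => ->.
  by apply: eq_bigl => i; case: (iter t p i =P j) => [->|_]; rewrite ?pj ?andbF.
have -> : \sum_(j | p j == Q) (if j == c0 then 0 else \sum_(t < L) y t j) =
    \sum_(t < L) y t.+1 Q.
  rewrite -(eq_bigr _ (fun t _ => step (val t))) exchange_big /=.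
  by apply: eq_bigr => j _; case: eqP => // _; rewrite big1.
have yL : y L Q = 0.
  by rewrite /y big1 // => j; rewrite pL eq_sym (negbTE Q0).
have y0 : y 0 Q = e Q by rewrite /y /= big_pred1_eq.
have := big_ord_recr (op := addn) (idx := 0) L (fun t : 'I_L.+1 => y t Q).
by rewrite big_ord_recl /= yL addn0 y0 => <-.
Qed.

(** The word with [a Q] copies of each [Q] is as long as [l]; reading it along [l] gives [t], and
    anything outside [l] falls on the default [c0]. *)
Lemma targets_exist (C : finType) (a : C -> nat) (T : eqType) (l : seq T) (c0 : C) :
  uniq l -> \sum_Q a Q = size l -> exists t : T -> C,
  (forall v, v \notin l -> t v = c0) /\ forall Q, count (fun v => t v == Q) l = a Q.
Proof.
move=> ul al.
pose Tg := flatten [seq nseq (a Q) Q | Q <- enum C].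
have sT : size Tg = size l.
  rewrite size_flatten /shape -map_comp sumnE big_map -al big_enum /=.
  by apply: eq_bigr => Q _; rewrite size_nseq.
exists (fun v => nth c0 Tg (index v l)); split=> [v|Q].
  by rewrite -index_mem -leqNgt => H; rewrite nth_default // sT.
have -> : count (fun v => nth c0 Tg (index v l) == Q) l = count_mem Q Tg.
  rewrite -[Tg in RHS](_ : [seq nth c0 Tg (index v l) | v <- l] = Tg) ?count_map //.
  case: l ul al sT => [|x0 l'] ul al sT; first by case: Tg sT.
  apply: (@eq_from_nth _ c0) => [|i]; rewrite size_map ?sT // => il.
  by rewrite (nth_map x0) // index_uniq.
rewrite count_flatten -map_comp sumnE big_map big_enum /= (bigD1 Q) //=.
rewrite count_nseq /= eqxx mul1n big1 ?addn0 // => j /negbTE jQ.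
by rewrite count_nseq /= jQ.
Qed.

(** The levels split into [k] at the centre, [L] in transit, and the settled rest. The last [k]
    doublings make the first two groups a [2 ^ - k] fraction of the tree; the count hypothesis lets
    every cell absorb these and the rounding errors. The third kind of adjacency arises only for
    leaves moved along [p]. *)
Lemma tree_to_cells (C : finType) (p : C -> C) (c0 : C) (L k : nat) (s : seq nat)
    (g : nat -> C) :
  p c0 = c0 -> (forall Q, iter L p Q = c0) ->
  0 < k -> size s = k + L + k -> all (fun x => 2 <= x) s ->
  (forall Q, 2 * L.+1 * #|C|.+1 * bt_size s <=
             2 ^ k * count (fun i => g i == Q) (iota 0 (bt_size s))) ->
  exists f : seq nat -> C,
    (forall a c, bt_vertex s (rcons a c) ->
       [\/ f a = f (rcons a c), f a = p (f (rcons a c)) | p (f a) = f (rcons a c)]) /\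
    perm_eq (map f (bt_vertices s)) (map g (iota 0 (bt_size s))).
Proof.
move=> pc0 pL k0 hs s2.
set n := bt_size s => Nbig.
pose N Q := count (fun i => g i == Q) (iota 0 n).
pose La j := \prod_(0 <= i < j) nth 0 s i.
pose W j := \prod_(k <= i < j) nth 0 s i.
pose ko := k + L.
have sz j : size (bt_level s j) = La j by rewrite size_bt_level /La big_mkord.
have nth2 j : j < size s -> 2 <= nth 0 s j by move=> jh; apply: (allP s2); exact: mem_nth.
have La2 j : j < size s -> 2 * La j <= La j.+1.
  by move=> /nth2 js; rewrite /La big_nat_recr //= mulnC leq_mul2l js orbT.
have W2 j : k <= j < size s -> 2 * W j <= W j.+1.
  by move=> /andP[kj /nth2 js]; rewrite /W big_nat_recr //= mulnC leq_mul2l js orbT.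
have LaW j : k <= j -> La j = La k * W j.
  by move=> kj; rewrite /La /W (big_cat_nat _ kj).
pose tau := \sum_(0 <= j < ko) La j.
pose b := \sum_(ko <= j < (size s).+1) W j.
have koh : ko + k = size s by rewrite hs.
have nE : n = tau + La k * b.
  rewrite /n /bt_size -(big_mkord predT (fun j => \prod_(i < j) nth 0 s i)).
  rewrite (eq_bigr La); last by move=> j _; rewrite /La big_mkord.
  rewrite (@big_cat_nat _ _ _ ko) //=; last by lia.
  congr (_ + _); rewrite /b big_distrr /=; apply: eq_big_nat => j /andP[koj _].
  by apply: LaW; lia.
have tau_le : 2 ^ k * tau <= La (size s).
  rewrite -koh; apply: leq_trans (exp2_doubling (F := La) _); last first.
    by move=> j jh; apply: La2; lia.
  by rewrite leq_mul2l orbC sum_doubling // => j jh; apply: La2; lia.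
have b_le : b <= 2 * W (size s).
  rewrite /b big_nat_recr /=; last by lia.
  rewrite mul2n -addnn leq_add2r; apply: sum_doubling; first lia.
  by move=> j jh; apply: W2; lia.
have Wh_gt0 : 0 < W (size s).
  by rewrite /W big_nat_cond prodn_cond_gt0 // => i /andP[/andP[_ /nth2 ih] _]; lia.
have Wh_le : W (size s) <= b.
  by rewrite /b big_nat_recr /= ?leq_addl //; lia.
have Lak : 2 ^ k <= La k.
  have := @exp2_doubling La 0 k; rewrite add0n /La [in X in _ * X]big_geq // muln1.
  by apply=> j jk; apply: La2; lia.
have La_le : La (size s) <= n.
  rewrite nE LaW; last by lia.
  by rewrite (leq_trans _ (leq_addl _ _)) // leq_mul2l Wh_le orbT.
(* [T] bounds the total excess: at most [b] per cell from rounding, plus the [tau] vertices above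
   level [ko], wherever they lie. *)
pose T := #|C| * b + tau.
have NT Q : 2 * L.+1 * T <= N Q.
  have tk : 2 ^ k * T <= #|C|.+1 * n.
    rewrite /T mulnDr mulSn addnC leq_add //; first exact: leq_trans La_le.
    rewrite mulnCA leq_mul2l; apply/orP; right.
    by rewrite nE (leq_trans _ (leq_addl _ _)) // leq_mul2r Lak orbT.
  rewrite -(leq_pmul2l (m := 2 ^ k)) ?expn_gt0 //.
  by apply: leq_trans (Nbig Q); rewrite mulnCA -!mulnA !leq_mul2l tk !orbT.
have sumN : \sum_Q N Q = n.
  have := count_partition g predT (iota 0 n); rewrite count_predT size_iota => ->.
  by apply: eq_bigr.
have b0 : 0 < b by lia.
(* [b] vertices at levels [>= ko] descend from each vertex of level [k]. *)
pose a0 Q := (N Q %/ b).+1.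
(* The quotient plus one ensures that a non-central cell never falls short of [N Q]; only excess has
   to be repaired. *)
have a0_lo Q : N Q <= a0 Q * b by rewrite /a0 ltnW // ltn_ceil.
have a0_hi Q : a0 Q * b <= N Q + b by rewrite /a0 mulSn addnC leq_add2r leq_divM.
have suma0 : \sum_(Q | Q != c0) a0 Q * b + N c0 <= n + #|C| * b.
  apply: (@leq_trans (\sum_(Q | Q != c0) (N Q + b) + N c0)).
    by rewrite leq_add2r leq_sum.
  rewrite big_split /= -sumN [in leqRHS](bigD1 c0) //=.
  suff sb : \sum_(Q | Q != c0) b <= #|C| * b.
    by rewrite addnAC leq_add // addnC.
  by rewrite -sum_nat_const [leqRHS](bigID (fun Q => Q != c0)) leq_addr.
(* The slack comes from the centre: [N c0] is at least [T], which covers the rounding total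
   [#|C| * b] and [tau]. *)
have suma0' : \sum_(Q | Q != c0) a0 Q <= La k.
  rewrite -(leq_pmul2r b0) big_distrl /=.
  have := NT c0; rewrite /T; move: suma0; rewrite nE; nia.
pose a Q := if Q == c0 then La k - \sum_(Q | Q != c0) a0 Q else a0 Q.
have suma : \sum_Q a Q = size (bt_level s k).
  rewrite sz (bigD1 c0) //= {1}/a eqxx [X in _ + X](eq_bigr a0) ?subnK //.
  by move=> Q /negbTE Q0; rewrite /a Q0.
have [tgt [tgt0 tgtE]] := targets_exist c0 (bt_level_uniq s k) suma.
(* At level [k] this is [c0], since [L] steps reach the centre; from level [ko] on it is the target.
   Above level [k], [take k v] is [v] itself, with default target [c0]. *)
pose f0 v := iter (ko - size v) p (tgt (take k v)).
have f0_bulk j Q : ko <= j -> count (fun v => f0 v == Q) (bt_level s j) = a Q * W j.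
  move=> koj; rewrite -tgtE -(@count_bt_level (fun v => tgt v == Q)); last by lia.
  apply: eq_in_count => v /size_bt_level_mem sv; rewrite /f0 sv.
  by have -> : ko - j = 0 by lia.
pose tr Q := \sum_(0 <= j < ko) count (fun v => f0 v == Q) (bt_level s j).
pose c Q := count (fun v => f0 v == Q) (bt_vertices s).
have cE Q : c Q = tr Q + a Q * b.
  rewrite /c count_bt_vertices -(big_mkord predT (fun j => count (fun v => f0 v == Q) (bt_level s j))).
  rewrite (@big_cat_nat _ _ _ ko) //=; last by lia.
  congr (_ + _); rewrite /b big_distrr /=; apply: eq_big_nat => j /andP[koj _].
  exact: f0_bulk.
have sumtr : \sum_Q tr Q = tau.
  rewrite /tr exchange_big /=; apply: eq_bigr => j _.
  by rewrite -sz -count_predT (count_partition f0); apply: eq_bigr.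
(* The centre needs no correction of its own: its count is forced by the total at the end. *)
pose e Q := if Q == c0 then 0 else c Q - N Q.
have sume : \sum_Q e Q <= T.
  apply: (@leq_trans (\sum_Q (b + tr Q))).
    apply: leq_sum => Q _; rewrite /e cE; case: eqP => // /eqP/negbTE Q0.
    by rewrite /a Q0; have := a0_hi Q; lia.
  by rewrite big_split /= sumtr sum_nat_const.
have [x [x0 xle xE]] := push_counts e pc0 pL.
pose lv := bt_level s (size s).
(* Leaves are at least half of the settled vertices, so a non-central [Q] holds at least
   [N Q / 2 >= L.+1 * T] of them, while at most [L * T] are to be moved. *)
have xleaf Q : x Q <= count (fun v => f0 v == Q) lv.
  have [->|Q0] := eqVneq Q c0; first by rewrite x0.
  rewrite f0_bulk; last by lia.
  rewrite /a (negbTE Q0).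
  have h1 : x Q <= L * T by apply: leq_trans (xle Q) _; rewrite leq_mul2l sume orbT.
  have := NT Q; have := a0_lo Q.
  have : a0 Q * b <= a0 Q * (2 * W (size s)) by rewrite leq_mul2l b_le orbT.
  by nia.
have [f1 [f1g f1c]] := shift_counts p (bt_level_uniq s (size s)) xleaf.
pose f v := if size v == size s then f1 v else f0 v.
have fcount Q : count (fun v => f v == Q) (bt_vertices s) + x Q =
    c Q + \sum_(j | p j == Q) x j.
  rewrite /c !count_bt_vertices !big_ord_recr /=.
  have -> : count (fun v => f v == Q) (bt_level s (size s)) =
      count (fun v => f1 v == Q) (bt_level s (size s)).
    by apply: eq_in_count => v /size_bt_level_mem sv; rewrite /f sv eqxx.
  rewrite -addnA f1c addnA; congr (_ + _ + _); apply: eq_bigr => j _.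
  apply: eq_in_count => v /size_bt_level_mem sv; rewrite /f sv.
  by rewrite ltn_eqF //= ltn_ord.
have fN Q : Q != c0 -> count (fun v => f v == Q) (bt_vertices s) = N Q.
  move=> Q0; have := fcount Q; rewrite xE // /e (negbTE Q0).
  have : N Q <= c Q by rewrite cE /a (negbTE Q0); have := a0_lo Q; lia.
  by lia.
exists f; split=> [v i|].
  rewrite /bt_vertex size_rcons => /andP[vh _].
  have fv : f v = f0 v by rewrite /f ltn_eqF.
  have f0v : f0 v = f0 (rcons v i) \/ f0 v = p (f0 (rcons v i)).
    rewrite /f0 size_rcons.
    have [vk|vk] := leqP k (size v).
      have -> : take k (rcons v i) = take k v by rewrite -cats1 takel_cat.
      have [vo|vo] := leqP ko (size v).
        by left; have -> : ko - size v = ko - (size v).+1 by lia.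
      by right; have -> : ko - size v = (ko - (size v).+1).+1 by lia.
    left; rewrite tgt0; last by rewrite take_oversize ?(ltnW vk) //; apply/negP => /size_bt_level_mem sv; rewrite sv ltnn in vk.
    rewrite iter_fixed //.
    have [vk'|vk'] := ltnP (size v).+1 k.
      rewrite tgt0 ?iter_fixed // take_oversize ?size_rcons ?(ltnW vk') //.
      by apply/negP => /size_bt_level_mem; rewrite size_rcons => sv; rewrite sv ltnn in vk'.
    by have -> : ko - (size v).+1 = L by rewrite /ko; lia.
  (* Only leaves are moved. As [k > 0], the parent of a leaf has already settled, so before the move
     both lie in the same cell. *)
  rewrite fv /f; case: eqP => [vs|_]; last by case: f0v => ->; [apply: Or31|apply: Or32].
  have f0v' : f0 v = f0 (rcons v i).
    rewrite size_rcons in vs.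
    have ksv : ko <= size v by rewrite -ltnS vs -koh -addn1 leq_add2l.
    have kv : k <= size v by rewrite (leq_trans _ ksv) // leq_addr.
    rewrite /f0 -cats1 takel_cat // size_cat /=.
    have /eqP -> : ko - size v == 0 by [].
    by have /eqP -> : ko - (size v + 1) == 0 by rewrite subn_eq0 ltnW // addn1.
  by case: (f1g (rcons v i)) => ->; rewrite f0v'; [apply: Or31|apply: Or33].
have cntN Q : count (fun v => f v == Q) (bt_vertices s) = N Q.
  have [->|Q0] := eqVneq Q c0; last exact: fN.
  have : \sum_Q count (fun v => f v == Q) (bt_vertices s) = \sum_Q N Q.
    rewrite sumN /n -size_bt_vertices -[RHS]count_predT (count_partition f).
    by apply: eq_bigr.
  by rewrite (bigD1 c0) //= [in RHS](bigD1 c0) //= (eq_bigr _ fN) => /addIn.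
apply/permP => P.
have cm (A : eqType) (u : A -> C) (l : seq A) :
  count P (map u l) = \sum_Q P Q * count (fun v => u v == Q) l.
  rewrite count_map (count_partition u); apply: eq_bigr => Q _.
  case PQ: (P Q); rewrite ?mul1n ?mul0n.
    by apply: eq_count => v /=; case: eqP => [->|]; rewrite ?PQ ?andbF.
  rewrite (eq_count (a2 := pred0)) ?count_pred0 // => v /=.
  by case: eqP => [->|]; rewrite ?PQ ?andbF.
by rewrite !cm; apply: eq_bigr => Q _; rewrite cntN.
Qed.

(** Equal cell counts allow vertices to be matched with indices inside each cell; the permutation
    [Is] is this matching, read along [bt_vertices s]. *)
Lemma cells_to_points (C : eqType) (f : seq nat -> C) (g : nat -> C) (s : seq nat) :
  perm_eq (map f (bt_vertices s)) (map g (iota 0 (bt_size s))) ->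
  exists phi : seq nat -> nat,
  [/\ forall a, bt_vertex s a -> phi a < bt_size s,
      forall a b, bt_vertex s a -> bt_vertex s b -> phi a = phi b -> a = b &
      forall a, bt_vertex s a -> g (phi a) = f a].
Proof.
have fin0 : [::] \in bt_vertices s by rewrite mem_bt_vertices.
move=> /(perm_iotaP (f [::]))[Is]; rewrite size_map size_iota => pIs fE.
pose phi a := nth 0 Is (index a (bt_vertices s)).
have sIs : size Is = bt_size s by rewrite (perm_size pIs) size_iota.
have uIs : uniq Is by rewrite (perm_uniq pIs) iota_uniq.
have idx a : bt_vertex s a -> index a (bt_vertices s) < bt_size s.
  by rewrite -mem_bt_vertices -index_mem size_bt_vertices.
have phin a : bt_vertex s a -> phi a < bt_size s.
  move=> /idx ia; have : phi a \in Is by rewrite mem_nth // sIs.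
  by rewrite (perm_mem pIs) mem_iota add0n.
exists phi; split=> // [a b va vb /eqP|a va].
  rewrite nth_uniq ?sIs ?idx // => /eqP iab.
  by rewrite -(nth_index [::] (s := bt_vertices s) (x := a)) ?mem_bt_vertices // iab nth_index ?mem_bt_vertices.
have := congr1 (fun l => nth (f [::]) l (index a (bt_vertices s))) fE.
rewrite (nth_map [::]) ?size_bt_vertices ?idx // nth_index ?mem_bt_vertices // => ->.
rewrite (nth_map 0) ?sIs ?idx // (nth_map 0) ?size_iota ?phin //.
by rewrite nth_iota ?phin.
Qed.

Local Open Scope classical_set_scope.
Local Open Scope ring_scope.

(** * Probabilities of empty cells and of coincidences *)

Lemma measure_bigU_le (R : realType) (dT : measure_display)
    (T : measurableType dT) (P : probability T R) (I : Type) (s : seq I)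
    (A : I -> set T) (e : R) :
  (forall i, measurable (A i)) -> (forall i, P (A i) <= e%:E)%E ->
  (P (\big[setU/set0]_(i <- s) A i) <= ((size s)%:R * e)%:E)%E.
Proof.
move=> mA Ae; elim: s => [|i s IH].
  by rewrite big_nil measure0 mul0r.
rewrite big_cons /= -[in leRHS]addn1 natrD mulrDl mul1r addrC EFinD.
apply: le_trans (leeD (Ae i) IH); apply: measureU2 => //.
exact: bigsetU_measurable.
Qed.

Lemma compl_indep (R : realType) (dT : measure_display)
    (T : measurableType dT) (P : probability T R) (I : eqType)
    (A : I -> set T) (p : R) :
  (forall i, measurable (A i)) ->
  (forall S, uniq S -> P (\big[setI/setT]_(i <- S) A i) = (p ^+ size S)%:E) ->
  forall S, uniq S -> P (\big[setI/setT]_(i <- S) ~` A i) = ((1 - p) ^+ size S)%:E.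
Proof.
move=> mA indA S uS.
(* Complementing one event is a subtraction, which brings back an intersection containing [A i].
   Hence the induction runs over mixed intersections: [S1] lists occurring events, [S2] failing
   ones. *)
suff H S1 S2 : uniq (S1 ++ S2) ->
    P (\big[setI/setT]_(i <- S1) A i `&` \big[setI/setT]_(i <- S2) ~` A i) =
    (p ^+ size S1 * (1 - p) ^+ size S2)%:E.
  by have := H [::] S uS; rewrite big_nil setTI mul1r.
elim: S2 S1 => [|i S2 IH] S1 u12.
  by rewrite big_nil setIT mulr1 indA //; move: u12; rewrite cats0.
have mB : measurable (\big[setI/setT]_(i <- S1) A i `&` \big[setI/setT]_(i <- S2) ~` A i).
  apply: measurableI; apply: bigsetI_measurable => // j _; exact: measurableC.
have u12' : uniq (S1 ++ S2).
  by move: u12; rewrite -cat1s uniq_catCA /= => /andP[].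
have ui : uniq ((i :: S1) ++ S2).
  by move: u12; rewrite -cat1s uniq_catCA.
rewrite big_cons setICA setIC -setDE.
set X := _ `&` _ in mB *.
transitivity (P X - P (X `&` A i))%E.
  apply: measureD => //.
  by apply: (@le_lt_trans _ _ 1%E); [exact: probability_le1|exact: ltry].
have -> : P (X `&` A i)
    = (p ^+ (size S1).+1 * (1 - p) ^+ size S2)%:E.
  by rewrite setIC /X setIA -(IH _ ui) big_cons.
by rewrite /X IH // -EFinB /= !exprS; congr (_%:E); ring.
Qed.

(** Half-open, so that the cells with [c < K] are disjoint and cover every coordinate in the unit
    interval except 1. *)
Definition grid_cell (R : realType) (K c : nat) : set R :=
  `[c%:R / K%:R, c.+1%:R / K%:R[.

Arguments grid_cell : clear implicits.

Lemma grid_cell_measure (R : realType) (K c : nat) : (c < K)%N ->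
  lebesgue_measure (grid_cell R K c `&` `[0%R, 1%R]) = ((K%:R)^-1)%:E.
Proof.
move=> cK; have K0 : 0 < K%:R :> R by rewrite ltr0n; lia.
have -> : grid_cell R K c `&` `[0%R, 1%R] = grid_cell R K c.
  apply/seteqP; split=> [x []//|x]; rewrite /grid_cell /= !in_itv /= => /andP[xl xr].
  split; first by rewrite xl xr.
  rewrite (le_trans _ xl) ?divr_ge0 //=; apply/ltW/(lt_le_trans xr).
  by rewrite ler_pdivrMr // mul1r ler_nat.
rewrite lebesgue_measure_itv /= lte_fin ltr_pM2r ?invr_gt0 // ltr_nat ltnSn.
by rewrite -EFinB -mulrBl -natrB // subSnn mul1r.
Qed.

Definition hit (R : realType) (d : nat) (T : Type) (U : nat -> 'I_d -> T -> R)
  (K : nat) (Q : 'I_d -> nat) (i : nat) : set T :=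
  [set w | forall k, grid_cell R K (Q k) (U i k w)].

Lemma hitE (R : realType) (d : nat) (T : Type) (U : nat -> 'I_d -> T -> R)
    (K : nat) (Q : 'I_d -> nat) (i : nat) :
  hit U K Q i = \big[setI/setT]_(k <- enum 'I_d) (U i k @^-1` grid_cell R K (Q k)).
Proof.
rewrite -bigcap_seq; apply/seteqP; split=> w H k; first by move=> _; exact: H.
by apply: H; rewrite /= mem_enum.
Qed.

Section iid.
Context (R : realType) (d : nat) (dT : measure_display) (T : measurableType dT)
  (P : probability T R) (U : nat -> 'I_d -> T -> R)
  (iidU : iid_uniform_points P U).

Lemma measurable_preim i k B : measurable B -> measurable (U i k @^-1` B).
Proof.
by move=> mB; rewrite -[X in measurable X]setTI; apply: (iidU.1 i k).
Qed.

Lemma measurable_hit K Q i : measurable (hit U K Q i).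
Proof.
rewrite hitE; apply: bigsetI_measurable => k _.
by apply: measurable_preim; exact: measurable_itv.
Qed.

(** The product rule is applied to all pairs of an index in [S] and a coordinate, each contributing
    a factor [1 / K]. *)
Lemma hit_indep K (Q : 'I_d -> nat) : (forall k, Q k < K)%N ->
  forall S, uniq S ->
  P (\big[setI/setT]_(i <- S) hit U K Q i) = (((K ^ d)%:R^-1) ^+ size S)%:E.
Proof.
move=> QK S uS; pose S2 := [seq (i, k) | i <- S, k <- enum 'I_d].
have uS2 : uniq S2.
  apply: allpairs_uniq => //; first exact: enum_uniq.
  by move=> [? ?] [? ?].
have -> : \big[setI/setT]_(i <- S) hit U K Q i =
    \bigcap_(j in [set` S2]) (U j.1 j.2 @^-1` grid_cell R K (Q j.2)).
  rewrite -bigcap_seq; apply/seteqP; split=> w H /=.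
    by move=> [i k] /allpairsP[[i' k'] [/= iS _ [-> ->]]]; exact: (H i' iS k').
  move=> i iS k; apply: (H (i, k)); apply/allpairsP; exists (i, k).
  by split=> //=; rewrite mem_enum.
rewrite (iidU.2 S2 (fun j => grid_cell R K (Q j.2)) uS2); last first.
  by move=> j _; exact: measurable_itv.
rewrite (eq_bigr (fun=> ((K%:R)^-1)%:E)); last first.
  by move=> j _; rewrite grid_cell_measure.
have pow (s : seq (nat * 'I_d)) (x : R) : (\prod_(j <- s) x%:E)%E = (x ^+ size s)%:E.
  by elim: s => [|a s IH]; rewrite ?big_nil // big_cons IH exprS EFinM.
by rewrite pow size_allpairs size_enum_ord mulnC natrX -exprVn -exprM.
Qed.

Lemma miss_prob K (Q : 'I_d -> nat) : (forall k, Q k < K)%N ->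
  forall S, uniq S ->
  P (\big[setI/setT]_(i <- S) ~` hit U K Q i) =
  ((1 - (K ^ d)%:R^-1) ^+ size S)%:E.
Proof.
move=> QK; apply: compl_indep => [i|]; first exact: measurable_hit.
exact: hit_indep.
Qed.

Definition outside i k := ~` (U i k @^-1` `[0%R, 1%R[).

Lemma outside_prob i k : P (outside i k) = 0%E.
Proof.
rewrite probability_setC; last by apply: measurable_preim; exact: measurable_itv.
have := iidU.2 [:: (i, k)] (fun=> [set` `[0%R, 1%R[]) isT (fun _ _ => measurable_itv _).
rewrite bigcap_seq !big_seq1 /= => ->.
have -> : [set` `[0%R, 1%R[] `&` [set` `[0%R, 1%R]] = [set` `[0%R, 1%R[] :> set R.
  apply/seteqP; split=> [x []//|x /=]; rewrite !in_itv /= => /andP[-> x1].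
  by rewrite x1 (ltW x1).
by rewrite lebesgue_measure_itv /= lte_fin ltr01 oppr0 adde0 subee.
Qed.

Definition same_coord i j k := [set w | U i k w = U j k w].

Lemma measurable_same_coord i j k : measurable (same_coord i j k).
Proof.
have -> : same_coord i j k = ([set: T] `&` [set w | U i k w <= U j k w]) `&`
   ([set: T] `&` [set w | U j k w <= U i k w]).
  apply/seteqP; split=> w /=; first by rewrite /same_coord /= => ->; rewrite lexx.
  by move=> [[_ a] [_ b]]; apply/eqP; rewrite eq_le a b.
by apply: measurableI; apply: measurable_fun_le => //; exact: (iidU.1 _ _).
Qed.

(** Apart from a null event, a coincidence puts both coordinates into the same one of [N] intervals.
    This has probability at most [N * N ^ -2 = 1 / N], with [N] arbitrarily large. *)
Lemma same_coord_prob i j k : i != j -> P (same_coord i j k) = 0%E.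
Proof.
move=> ij; apply/eqP; rewrite eq_le measure_ge0 andbT.
apply/lee_addgt0Pr => e e0; rewrite add0e.
pose N := (Num.truncn e^-1).+1.
have N0 : 0 < N%:R :> R by rewrite ltr0n.
have Ne : N%:R^-1 <= e.
  by rewrite -[leRHS]invrK lef_pV2 ?posrE ?invr_gt0 // ltW // truncnS_gt.
pose B c := U i k @^-1` grid_cell R N c `&` U j k @^-1` grid_cell R N c.
have mB c : measurable (B c).
  by apply: measurableI; apply: measurable_preim; exact: measurable_itv.
have mO : measurable (outside i k).
  by apply: measurableC; apply: measurable_preim; exact: measurable_itv.
have PB (c : 'I_N) : (P (B c) <= (N%:R^-1 * N%:R^-1)%:E)%E.
  have u2 : uniq [:: (i, k); (j, k)] by rewrite /= inE xpair_eqE (negbTE ij).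
  have := iidU.2 [:: (i, k); (j, k)] (fun=> grid_cell R N c) u2
     (fun _ _ => measurable_itv _).
  rewrite bigcap_seq !big_cons !big_nil /= setIT mule1 => PBE.
  by rewrite /B PBE !grid_cell_measure // EFinM.
have sub : same_coord i j k `<=` outside i k `|` \big[setU/set0]_(c <- enum 'I_N) B c.
  move=> w /= ijw.
  have [/= /andP[w0 w1]|] := boolP (0 <= U i k w < 1); last first.
    by move=> H; left; rewrite /outside /= in_itv /=; exact/negP.
  right; rewrite -bigcup_seq.
  have /andP[t1 t2] : (Num.truncn (U i k w * N%:R))%:R <= U i k w * N%:R
      < (Num.truncn (U i k w * N%:R)).+1%:R by rewrite truncn_itv // mulr_ge0.
  have tN : (Num.truncn (U i k w * N%:R) < N)%N.
    by rewrite -(ltr_nat R) (le_lt_trans t1) // gtr_pMl.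
  exists (Ordinal tN) => //=; first by rewrite mem_enum.
  have inC : grid_cell R N (Num.truncn (U i k w * N%:R)) (U i k w).
    by rewrite /grid_cell /= in_itv /= ler_pdivrMr // ltr_pdivlMr // t1 t2.
  by split=> //=; rewrite -ijw.
apply: (@le_trans _ _ (P (outside i k `|` \big[setU/set0]_(c <- enum 'I_N) B c))).
  apply: le_measure => //; rewrite inE; first exact: measurable_same_coord.
  by apply: measurableU => //; exact: bigsetU_measurable.
apply: (@le_trans _ _ (P (outside i k) + P (\big[setU/set0]_(c <- enum 'I_N) B c))%E).
  by apply: measureU2 => //; exact: bigsetU_measurable.
rewrite outside_prob add0e.
apply: le_trans (measure_bigU_le _ _ PB) _ => //.
by rewrite size_enum_ord mulrA mulfV ?gt_eqF // mul1r lee_fin.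
Qed.

End iid.

(** * Measurability of the two events *)

Section meas.
Context (dT : measure_display) (T : measurableType dT).

Lemma measurable_exists (I : countType) (A : I -> set T) :
  (forall i, measurable (A i)) -> measurable [set w | exists i, A i w].
Proof.
move=> mA; have -> : [set w | exists i, A i w] = \bigcup_i A i.
  by apply/seteqP; split=> w [i]; [exists i|move=> _ ?; exists i].
exact: countable_bigcupT_measurable.
Qed.

Lemma measurable_forall (I : countType) (A : I -> set T) :
  (forall i, measurable (A i)) -> measurable [set w | forall i, A i w].
Proof.
move=> mA; have -> : [set w | forall i, A i w] = ~` [set w | exists i, (~` A i) w].
  apply/seteqP; split=> w /=; first by move=> H [i]; apply.
  by move=> /forallNP H i; apply: contrapT; exact: H.
by apply: measurableC; apply: measurable_exists => i; exact: measurableC.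
Qed.

Lemma measurable_imply (p : Prop) (A : set T) :
  (p -> measurable A) -> measurable [set w | p -> A w].
Proof.
move=> mA; have [pt|pf] := pselect p.
  have -> : [set w | p -> A w] = A by apply/seteqP; split=> w //=; apply.
  exact: mA.
by have -> : [set w | p -> A w] = setT by apply/seteqP; split=> w //= _ /pf.
Qed.

Lemma measurable_const (p : Prop) : measurable [set _ : T | p].
Proof.
have [pt|pf] := pselect p.
  by have -> : [set _ : T | p] = setT by apply/seteqP; split.
by have -> : [set _ : T | p] = set0 by apply/seteqP; split=> w //= /pf.
Qed.

Lemma prob_ge_compl (R : realType) (P : probability T R) (A B : set T) (e : R) :
  measurable A -> measurable B -> ~` B `<=` A -> (P B <= e%:E)%E ->
  ((1 - e)%:E <= P A)%E.
Proof.
move=> mA mB BA Pe; apply: (@le_trans _ _ (P (~` B))); last first.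
  by apply: le_measure => //; rewrite inE //; exact: measurableC.
by rewrite probability_setC // EFinB leeB.
Qed.

Lemma measurable_edist (R : realType) (d : nat) (U : nat -> 'I_d -> T -> R) i j r :
  (forall i k, measurable_fun setT (U i k)) ->
  measurable [set w | Defs.edist (pt U i w) (pt U j w) <= r].
Proof.
move=> mU; rewrite -[X in measurable X]setTI.
apply: measurable_fun_le => //.
have ms : measurable_fun [set: R] (Num.sqrt : R -> R).
  exact: continuous_measurable_fun (@sqrt_continuous R).
apply: (measurableT_comp ms).
apply: measurable_sum => k; apply: measurable_funX.
by apply: measurable_funB; exact: mU.
Qed.

Lemma bt_vertex_rcons s a c : bt_vertex s (rcons a c) -> bt_vertex s a.
Proof.
rewrite /bt_vertex size_rcons => /andP[ah /allP H]; rewrite (ltnW ah) /=.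
apply/allP => i; rewrite mem_iota add0n => /= ia.
have := H i; rewrite mem_iota add0n ltnS (ltnW ia) => /(_ isT).
by rewrite nth_rcons ia.
Qed.

(** Only the values of [phi] on the finitely many vertices matter, so [phi] is coded by a finite
    list [t]. The union over all [phi] thereby becomes countable. *)
Lemma measurable_contains (R : realType) (d : nat) (U : nat -> 'I_d -> T -> R) r n s :
  (forall i k, measurable_fun setT (U i k)) ->
  (forall i j k, measurable [set w | U i k w = U j k w]) ->
  measurable [set w | contains_bt U r n s w].
Proof.
move=> mU mE.
pose ph (t : seq nat) a := nth 0%N t (index a (bt_vertices s)).
have -> : [set w | contains_bt U r n s w] = [set w | exists t : seq nat,
  (([set w | (forall a, bt_vertex s a -> (ph t a < n)%N)] `&`
   [set w | forall a b : seq nat, (bt_vertex s a /\ bt_vertex s b /\ a <> b) ->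
           ~ (forall k, U (ph t a) k w = U (ph t b) k w)]) `&`
   [set w | forall (a : seq nat) (c : nat), bt_vertex s (rcons a c) ->
           Defs.edist (pt U (ph t a) w) (pt U (ph t (rcons a c)) w) <= r]) w].
  apply/seteqP; split=> w /=; last first.
    move=> [t [[h1 h2] h3]]; exists (ph t); split=> // a b va vb ab ptE.
    by apply: (h2 a b) => // k; exact: (congr1 (fun f => f k) ptE).
  move=> [phi [h1 h2 h3]]; exists (map phi (bt_vertices s)).
  have phE a : bt_vertex s a -> ph (map phi (bt_vertices s)) a = phi a.
    rewrite -mem_bt_vertices => va.
    by rewrite /ph (nth_map [::]) ?index_mem // nth_index.
  split; [split|] => [a va|a b [va [vb ab]] H|a c vac].
  - by rewrite phE //; exact: h1.
  - apply: (h2 a b va vb ab); apply/funext => k; rewrite /pt -(phE a va) -(phE b vb).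
    exact: H.
  - by rewrite !phE ?(bt_vertex_rcons vac) //; exact: h3.
apply: measurable_exists => t; apply: measurableI; first apply: measurableI.
- exact: measurable_const.
- apply: measurable_forall => a; apply: measurable_forall => b.
  apply: measurable_imply => _; apply: measurableC.
  by apply: measurable_forall => k; exact: mE.
- apply: measurable_forall => a; apply: measurable_forall => c.
  by apply: measurable_imply => _; exact: measurable_edist.
Qed.

Lemma measurable_event_E (R : realType) (d : nat) (U : nat -> 'I_d -> T -> R) r M h :
  (forall i k, measurable_fun setT (U i k)) ->
  (forall i j k, measurable [set w | U i k w = U j k w]) ->
  measurable (event_E U r M h).
Proof.
move=> mU mE; apply: measurable_forall => s; apply: measurable_imply => _.
exact: measurable_contains.
Qed.

Lemma measurable_event_F (R : realType) (d : nat) (U : nat -> 'I_d -> T -> R) r M h :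
  (forall i k, measurable_fun setT (U i k)) ->
  (forall i j k, measurable [set w | U i k w = U j k w]) ->
  measurable (event_F U r M h).
Proof.
move=> mU mE; apply: measurable_forall => s; apply: measurable_imply => _.
by apply: measurableC; exact: measurable_contains.
Qed.

End meas.

(** * Distances and elementary estimates *)

(** Cauchy-Schwarz against the constant vector, by expanding the squares of [d * z k - S]. Dimension
    0 is separate because a factor [d] is cancelled. *)
Lemma sqr_sum_le (R : realType) (d : nat) (z : 'I_d -> R) :
  (\sum_k z k) ^+ 2 <= d%:R * \sum_k z k ^+ 2.
Proof.
case: d z => [|d] z; first by rewrite !big_ord0 expr2 mulr0.
set S := \sum_k z k; set Q := \sum_k z k ^+ 2.
have D0 : 0 < d.+1%:R :> R by rewrite ltr0n.
have : 0 <= \sum_k (d.+1%:R * z k - S) ^+ 2 by apply: sumr_ge0 => k _; exact: sqr_ge0.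
have -> : \sum_k (d.+1%:R * z k - S) ^+ 2 = d.+1%:R * (d.+1%:R * Q - S ^+ 2).
  rewrite (eq_bigr (fun k => d.+1%:R ^+ 2 * z k ^+ 2 + (- (2 * d.+1%:R * S) * z k + S ^+ 2))).
    rewrite !big_split /= -!mulr_sumr sumr_const card_ord -mulr_natl -/S -/Q; ring.
  by move=> k _; ring.
by rewrite pmulr_rge0 // subr_ge0.
Qed.

Lemma sum_sub_le_edist (R : realType) (d : nat) (x y : 'I_d -> R) :
  `|\sum_k x k - \sum_k y k| <= Num.sqrt d%:R * Defs.edist x y.
Proof.
rewrite -sumrB -sqrtr_sqr /Defs.edist -sqrtrM ?ler0n //.
by apply: ler_wsqrtr; exact: sqr_sum_le.
Qed.

Lemma edist_le (R : realType) (d : nat) (x y : 'I_d -> R) (t : R) : 0 <= t ->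
  (forall k, `|x k - y k| <= t) -> Defs.edist x y <= Num.sqrt d%:R * t.
Proof.
move=> t0 xyt; rewrite -[in leRHS](ger0_norm t0) -(sqrtr_sqr t) -sqrtrM ?ler0n //.
apply: ler_wsqrtr.
have -> : d%:R * t ^+ 2 = \sum_(k < d) t ^+ 2 by rewrite sumr_const card_ord mulr_natl.
by apply: ler_sum => k _; rewrite -(real_normK (num_real _)) ler_sqr ?nnegrE ?normr_ge0.
Qed.

(** With exactly [bt_size s] indices available, the injective [phi] is onto, so [i] and [j] are
    images of vertices. Each is compared with the root along at most [size s] edges. *)
Lemma contains_bt_diameter (R : realType) (d : nat) (T : Type)
    (U : nat -> 'I_d -> T -> R) (r : R) (s : seq nat) (w : T) i j :
  0 <= r -> contains_bt U r (bt_size s) s w -> (i < bt_size s)%N -> (j < bt_size s)%N ->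
  `|\sum_k U i k w - \sum_k U j k w| <= (2 * size s)%:R * (Num.sqrt d%:R * r).
Proof.
move=> r0 [phi [phin phid phie]].
pose sg a := \sum_k U (phi a) k w.
have r0' : 0 <= Num.sqrt d%:R * r by rewrite mulr_ge0 ?sqrtr_ge0.
have root_dist a : bt_vertex s a -> `|sg a - sg [::]| <= (size s)%:R * (Num.sqrt d%:R * r).
  move=> va; apply: (@le_trans _ _ ((size a)%:R * (Num.sqrt d%:R * r))); last first.
    by rewrite ler_wpM2r // ler_nat; case/andP: va.
  elim/last_ind: a va => [|a c IH] va; first by rewrite subrr normr0 mul0r.
  have va' := bt_vertex_rcons va.
  rewrite size_rcons -[_.+1]addn1 natrD mulrDl mul1r [leRHS]addrC.
  have -> : sg (rcons a c) - sg [::] = (sg (rcons a c) - sg a) + (sg a - sg [::]) by ring.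
  apply: le_trans (ler_normD _ _) (lerD _ (IH va')).
  rewrite distrC; apply: le_trans (sum_sub_le_edist _ _) _.
  by rewrite ler_wpM2l ?sqrtr_ge0 //; exact: phie.
have surj i' : (i' < bt_size s)%N -> exists2 a, bt_vertex s a & phi a = i'.
  move=> i'n; have ut : uniq (map phi (bt_vertices s)).
    rewrite map_inj_in_uniq ?bt_vertices_uniq // => a b.
    rewrite !mem_bt_vertices => va vb pab; apply: contrapT => ab.
    by apply: (phid a b va vb ab); rewrite pab.
  have sub : {subset map phi (bt_vertices s) <= iota 0 (bt_size s)}.
    move=> x /mapP[a]; rewrite mem_bt_vertices => va ->.
    by rewrite mem_iota add0n /=; exact: phin.
  have [|_ eqm] := uniq_min_size ut sub.
    by rewrite size_map size_bt_vertices size_iota.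
  have : i' \in map phi (bt_vertices s) by rewrite eqm mem_iota add0n.
  by move=> /mapP[a]; rewrite mem_bt_vertices => va ->; exists a.
move=> /surj[a va <-] /surj[b vb <-].
have -> : \sum_k U (phi a) k w - \sum_k U (phi b) k w = (sg a - sg [::]) - (sg b - sg [::]).
  by rewrite /sg; ring.
apply: le_trans (ler_normB _ _) _.
by rewrite natrM mulr2n !mulrDl !mul1r lerD ?root_dist.
Qed.

(** With [j = k %/ e.+1], one factor [j.+1] absorbs the constants, and
    [j.+1 ^ e.+1 <= 2 ^ (j * e.+1)]. *)
Lemma poly_le_exp2 C e : exists k0, forall k, (k0 <= k)%N -> (C * k.+1 ^ e <= 2 ^ k)%N.
Proof.
exists (e.+1 * (C * e.+1 ^ e))%N => k kk.
pose j := (k %/ e.+1)%N.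
have jk : (j * e.+1 <= k)%N by exact: leq_divM.
have kj : (k < j.+1 * e.+1)%N by exact: ltn_ceil.
have jbig : (C * e.+1 ^ e <= j)%N by rewrite leq_divRL // mulnC.
apply: (@leq_trans (C * (j.+1 * e.+1) ^ e)%N).
  rewrite leq_mul2l; apply/orP; right.
  by case: (posnP e) => [->|e0]; rewrite ?expn0 // leq_exp2r.
apply: (@leq_trans (j.+1 ^ e.+1)%N).
  by rewrite expnMn mulnCA expnSr leq_mul2l ltnW ?orbT // ltnS.
apply: (@leq_trans ((2 ^ j) ^ e.+1)%N); first by rewrite leq_exp2r // ltn_expl.
by rewrite -expnM leq_exp2l.
Qed.

Lemma bernoulli_ge (R : realType) (x : R) n : 0 <= x -> 1 + n%:R * x <= (1 + x) ^+ n.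
Proof.
move=> x0; elim: n => [|n IH]; first by rewrite mul0r addr0 expr0.
rewrite exprS; apply: (@le_trans _ _ ((1 + x) * (1 + n%:R * x))); last first.
  by rewrite ler_wpM2l // addr_ge0.
rewrite -natr1; have : 0 <= n%:R * x ^+ 2 by rewrite mulr_ge0 // sqr_ge0.
by nra.
Qed.

(** Each run of [m] attempts halves the chance of a miss: [(1 - 1/m)^m * (1 + 1/m)^m <= 1], and the
    second factor is at least 2 by Bernoulli. *)
Lemma exp_miss_le (R : realType) (m j : nat) : (0 < m)%N ->
  (1 - m%:R^-1) ^+ (m * j) <= (2^-1 : R) ^+ j.
Proof.
move=> m0; have M0 : 0 < m%:R :> R by rewrite ltr0n.
have iM1 : m%:R^-1 <= 1 :> R by rewrite invf_le1 // ler1n.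
have iM0 : 0 <= m%:R^-1 :> R by rewrite invr_ge0 ltW.
rewrite exprM; apply: lerXn2r; rewrite ?nnegrE ?exprn_ge0 ?subr_ge0 ?invr_ge0 //.
have h1 : 2 <= (1 + m%:R^-1 : R) ^+ m.
  by apply: le_trans (bernoulli_ge m iM0); rewrite mulfV ?gt_eqF //.
have h2 : (1 - m%:R^-1 : R) ^+ m * (1 + m%:R^-1) ^+ m <= 1.
  rewrite -exprMn; apply: exprn_ile1; first by nra.
  by have := sqr_ge0 (m%:R^-1 : R); nra.
have h3 : 0 <= (1 - m%:R^-1 : R) ^+ m by rewrite exprn_ge0 // subr_ge0.
by rewrite -[leRHS]mul1r ler_pdivlMr //; nra.
Qed.

Lemma bt_size_ge s : all (fun x => 2 <= x)%N s -> (2 ^ size s <= bt_size s)%N.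
Proof.
move=> s2; rewrite /bt_size big_ord_recr /=; apply: leq_trans (leq_addl _ _).
rewrite -[in X in (X <= _)%N](card_ord (size s)) -prod_nat_const.
by apply: leq_prod => i _; apply: (allP s2); exact: mem_nth.
Qed.

(** A crude bound from [h < 2 ^ h], uniform over the trees; it limits the indices entering the union
    bound. *)
Lemma bt_size_le h s : size s = h -> all (fun x => x <= h)%N s ->
  (bt_size s <= 2 ^ (h + h * h))%N.
Proof.
move=> <- sh; rewrite /bt_size.
have lev (j : 'I_(size s).+1) : (\prod_(i < j) nth 0 s i <= 2 ^ (size s * size s))%N.
  apply: (@leq_trans (\prod_(i < j) 2 ^ size s)%N).
    apply: leq_prod => i _; apply: leq_trans (ltnW (ltn_expl _ _)) => //.
    by apply: (allP sh); apply: mem_nth; apply: leq_trans (ltn_ord i) _; rewrite -ltnS.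
  rewrite prod_nat_const card_ord -expnM leq_exp2l // leq_mul2l.
  by have := ltn_ord j; rewrite ltnS => ->; rewrite orbT.
apply: leq_trans (leq_sum _ (fun j _ => lev j)) _.
by rewrite sum_nat_const card_ord expnD leq_mul2r ltn_expl ?orbT.
Qed.

(** * The two threshold bounds *)

Lemma prob_cvg1 (R : realType) (dT : measure_display) (T : measurableType dT)
    (P : probability T R) (A : nat -> set T) (e : nat -> R) :
  (forall h, measurable (A h)) ->
  (\forall h \near \oo, ((1 - e h)%:E <= P (A h))%E) ->
  e @ \oo --> (0 : R) -> (fun h => P (A h)) @ \oo --> 1%E.
Proof.
move=> mA lo e0.
apply: (@squeeze_cvge _ _ _ _ (fun h => (1 - e h)%:E) _ (fun=> 1%E)).
- by near=> h; apply/andP; split; [near: h | exact: probability_le1].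
- apply: cvg_EFin; first by near=> h.
  rewrite -[X in _ --> X]subr0; apply: cvgB => //; exact: cvg_cst.
- exact: cvg_cst.
Unshelve. all: by end_near. Qed.

(** If the first [2 ^ h] points miss neither of the two opposite corner cells, two of them violate
    [contains_bt_diameter]. Weakening the exponent [2 ^ h] to [h] gives a geometric error. *)
Lemma event_F_prob (R : realType) (d : nat) (dT : measure_display)
    (T : measurableType dT) (P : probability T R) (U : nat -> 'I_d -> T -> R)
    (eps r : R) (M h K : nat) : iid_uniform_points P U -> (0 < d)%N ->
  (0 < h)%N -> 0 <= r -> r <= (1 - eps) * (Num.sqrt d%:R / (2 * h%:R)) ->
  2 / K.+1%:R < eps ->
  ((1 - 2 * (1 - (K.+1 ^ d)%:R^-1) ^+ h)%:E <= P (event_F U r M h))%E.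
Proof.
move=> iidU d0 h0 r0 rle Keps.
pose miss c := \big[setI/setT]_(i <- iota 0 (2 ^ h)) ~` hit U K.+1 (fun=> c) i.
have m1 : 0 <= ((K.+1 ^ d)%:R^-1 : R) <= 1.
  apply/andP; split; first by rewrite invr_ge0.
  by rewrite invf_le1 ?ltr0n ?expn_gt0 // ler1n expn_gt0.
have mmiss c : measurable (miss c).
  by apply: bigsetI_measurable => i _; apply: measurableC; exact: measurable_hit iidU _ _ _.
have Pmiss c : (c < K.+1)%N -> (P (miss c) <= ((1 - (K.+1 ^ d)%:R^-1) ^+ h)%:E)%E.
  move=> cK; rewrite /miss (miss_prob iidU) ?iota_uniq //.
  by rewrite lee_fin size_iota ler_wiXn2l ?(ltnW (ltn_expl _ _)) //; lra.
apply: (@prob_ge_compl _ _ _ _ _ (miss 0%N `|` miss K)).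
- apply: measurable_event_F; first exact: iidU.1.
  by move=> i j k; exact: measurable_same_coord iidU _ _ _.
- exact: measurableU.
- move=> w /not_orP[miss0 missK] s /andP[/eqP sh /allP s2] hasT.
  have hitc c : ~ miss c w -> exists2 i, (i < 2 ^ h)%N & hit U K.+1 (fun=> c) i w.
    rewrite /miss -bigcap_seq => /existsNP[i]; rewrite not_implyE => -[/= iin] /contrapT.
    by exists i => //; move: iin; rewrite mem_iota.
  have [i ih hi] := hitc _ miss0; have [j jh hj] := hitc _ missK.
  have sn : (2 ^ h <= bt_size s)%N.
    by rewrite -sh; apply: bt_size_ge; apply/allP => x /s2 /andP[].
  have := contains_bt_diameter r0 hasT (leq_trans jh sn) (leq_trans ih sn).
  rewrite sh leNgt => /negP; apply.
  have D0 : 0 < d%:R :> R by rewrite ltr0n.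
  have H0 : 0 < h%:R :> R by rewrite ltr0n.
  have K0 : 0 < K.+1%:R :> R by rewrite ltr0n.
  apply: (@le_lt_trans _ _ ((1 - eps) * d%:R)).
    rewrite -[in leRHS](sqr_sqrtr (ltW D0)) natrM.
    apply: (@le_trans _ _ (2 * h%:R * (Num.sqrt d%:R *
       ((1 - eps) * (Num.sqrt d%:R / (2 * h%:R)))))).
      by rewrite ler_pM2l ?mulr_gt0 // ler_wpM2l ?sqrtr_ge0.
    by rewrite le_eqVlt; apply/orP; left; apply/eqP; field; rewrite gt_eqF.
  (* [1 - 2 / K.+1] is the gap between the first and the last of [K.+1] cells on one axis. *)
  apply: (@lt_le_trans _ _ (d%:R * (1 - 2 / K.+1%:R))).
    by rewrite mulrC ltr_pM2l // ltrD2l ltrN2.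
  apply: (@le_trans _ _ (\sum_k U j k w - \sum_k U i k w)); last exact: ler_norm.
  have -> : d%:R * (1 - 2 / K.+1%:R) = \sum_(k < d) (1 - 2 / K.+1%:R) :> R.
    by rewrite sumr_const card_ord mulr_natl.
  rewrite -sumrB; apply: ler_sum => k _.
  have := hi k; have := hj k; rewrite /grid_cell /= !in_itv /= => /andP[a1 _] /andP[_ a2].
  have -> : 1 - 2 / K.+1%:R = K%:R / K.+1%:R - 1 / K.+1%:R :> R.
    by rewrite -{1}(mulfV (lt0r_neq0 K0)) -!mulrBl; congr (_ / _); rewrite -natr1; ring.
  by rewrite lerB // ltW.
- apply: (@le_trans _ _ (P (miss 0%N) + P (miss K))%E); first exact: measureU2.
  by rewrite mulr2n mulrDl mul1r EFinD leeD ?Pmiss.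
Qed.

(** * The grid retraction towards the central cell, and the embedding of trees *)

Definition toward (c0 q c : nat) : nat :=
  if (c0 <= c)%N then maxn (c - q) c0 else minn (c + q) c0.

Lemma toward_bounds c0 q c :
  [/\ (c <= toward c0 q c + q)%N, (toward c0 q c <= c + q)%N &
      (toward c0 q c <= maxn c c0)%N].
Proof. by rewrite /toward; case: ifP => ?; split; lia. Qed.

Lemma iter_toward c0 q t c : (c <= c0 + t * q)%N -> (c0 <= c + t * q)%N ->
  iter t (toward c0 q) c = c0.
Proof.
elim: t c => [|t IH] c cu cl; first by rewrite /=; lia.
rewrite iterSr; apply: IH; rewrite /toward; case: ifP => ?; lia.
Qed.

Definition toward_cell (d K' c0 q : nat) (Q : {ffun 'I_d -> 'I_K'.+1}) :
  {ffun 'I_d -> 'I_K'.+1} := [ffun k => inord (toward c0 q (Q k))].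

Lemma toward_cellE d K' c0 q (Q : {ffun 'I_d -> 'I_K'.+1}) k : (c0 <= K')%N ->
  toward_cell c0 q Q k = toward c0 q (Q k) :> nat.
Proof.
move=> cK; rewrite ffunE inordK // ltnS.
by have [_ _ H] := toward_bounds c0 q (Q k); have := ltn_ord (Q k); lia.
Qed.

(** With [2 * c0 + 1] cells per axis, every cell is within [c0 = t * q] of the middle one in each
    coordinate. *)
Lemma iter_toward_cell d c0 q t (Q : {ffun 'I_d -> 'I_(2 * c0).+1}) : c0 = (t * q)%N ->
  iter t (toward_cell c0 q) Q = [ffun k => inord c0].
Proof.
move=> c0E; apply/ffunP => k; apply: val_inj; rewrite /= ffunE inordK ?ltnS ?leq_pmull //.
have -> n : iter n (toward_cell c0 q) Q k = iter n (toward c0 q) (Q k) :> nat.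
  by elim: n => //= n IH; rewrite toward_cellE ?IH // leq_pmull.
by apply: iter_toward; have := ltn_ord (Q k); lia.
Qed.

Lemma count_blocks (P : pred nat) B q :
  (forall j, (j < q)%N -> exists2 i, (j * B <= i < j * B + B)%N & P i) ->
  (q <= count P (iota 0 (q * B)))%N.
Proof.
elim: q => // q IH H; rewrite mulSn addnC iotaD count_cat add0n -addn1 leq_add ?IH //.
  by move=> j jq; apply: H; rewrite ltnS ltnW.
have [i iB Pi] := H q (ltnSn q).
by rewrite -has_count; apply/hasP; exists i => //; rewrite mem_iota.
Qed.

(** The deterministic part: the sample [w] enters only through the last three hypotheses, on the
    range of the points, their distinctness and the blocks. A side of [2 * (L * q) + 1] cells lets
    [L] steps of size [q] reach the middle. *)
Lemma contains_bt_grid (R : realType) (d : nat) (T : Type)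
    (U : nat -> 'I_d -> T -> R) (r : R) (s : seq nat) (w : T) (k L q B : nat) :
  let K := (2 * (L * q)).+1 in let n := bt_size s in
  (0 < k)%N -> size s = (k + L + k)%N -> all (fun x => 2 <= x)%N s ->
  (2 * L.+1 * (K ^ d).+1 * n <= 2 ^ k * (n %/ B))%N ->
  Num.sqrt d%:R * (q.+1%:R / K%:R) <= r ->
  (forall i c, (i < n)%N -> 0 <= U i c w < 1) ->
  (forall i j, (i < n)%N -> (j < n)%N -> i <> j -> pt U i w <> pt U j w) ->
  (forall (Q : {ffun 'I_d -> 'I_K}) j, (j < n %/ B)%N ->
     exists2 i, (j * B <= i < j * B + B)%N & hit U K (fun c => nat_of_ord (Q c)) i w) ->
  contains_bt U r n s w.
Proof.
move=> K n k0 sz s2 num rK U01 dist blocks.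
have K0 : 0 < K%:R :> R by rewrite ltr0n.
pose g i : {ffun 'I_d -> 'I_K} := [ffun c => inord (Num.truncn (U i c w * K%:R))].
have hitg i (Q : {ffun 'I_d -> 'I_K}) : hit U K (fun c => nat_of_ord (Q c)) i w -> g i = Q.
  move=> hi; apply/ffunP => c; apply: val_inj; rewrite ffunE /=.
  have := hi c; rewrite /grid_cell /= in_itv /= ler_pdivrMr // ltr_pdivlMr // => /truncn_def ->.
  by rewrite inordK.
have ghit i c : (i < n)%N ->
   (g i c)%:R / K%:R <= U i c w < (g i c).+1%:R / K%:R.
  move=> /(U01 i c) /andP[u0 u1]; rewrite ler_pdivrMr // ltr_pdivlMr //.
  have /andP[t1 t2] : (Num.truncn (U i c w * K%:R))%:R <= U i c w * K%:R
      < (Num.truncn (U i c w * K%:R)).+1%:R by rewrite truncn_itv // mulr_ge0.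
  by rewrite ffunE inordK ?t1 // -(ltr_nat R) (le_lt_trans t1) // gtr_pMl.
pose c0 := (L * q)%N.
pose p : {ffun 'I_d -> 'I_K} -> {ffun 'I_d -> 'I_K} := toward_cell c0 q.
pose ctr : {ffun 'I_d -> 'I_K} := [ffun=> inord c0].
have pctr : p ctr = ctr.
  apply/ffunP => c; apply: val_inj; rewrite /= toward_cellE ?leq_pmull //.
  by rewrite ffunE inordK ?ltnS ?leq_pmull // /toward leqnn; lia.
have pL Q : iter L p Q = ctr by exact: iter_toward_cell.
have Ng Q : (2 * L.+1 * #|{ffun 'I_d -> 'I_K}|.+1 * n <=
    2 ^ k * count (fun i => g i == Q) (iota 0 n))%N.
  rewrite card_ffun !card_ord; apply: leq_trans num _; rewrite leq_mul2l; apply/orP; right.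
  (* Each of the [n %/ B] full blocks gives an index in [Q]; the incomplete last block is
     dropped. *)
  rewrite [in leqRHS](divn_eq n B) iotaD count_cat (leq_trans _ (leq_addr _ _)) //.
  apply: count_blocks => j jn; have [i iB hi] := blocks Q j jn.
  by exists i => //; apply/eqP; exact: hitg.
have [f [fadj fperm]] := tree_to_cells pctr pL k0 sz s2 Ng.
have [phi [phin phii phig]] := cells_to_points fperm.
exists phi; split=> // [a b va vb ab|a c vac].
  by apply: dist; rewrite ?phin // => /phii H; apply: ab; exact: H.
apply: le_trans rK; apply: edist_le => [|e]; first by rewrite divr_ge0.
have va := bt_vertex_rcons vac.
have close : (g (phi a) e <= g (phi (rcons a c)) e + q)%N /\
             (g (phi (rcons a c)) e <= g (phi a) e + q)%N.
  rewrite !phig //; have pb (Q : {ffun 'I_d -> 'I_K}) : (Q e <= p Q e + q)%N /\ (p Q e <= Q e + q)%N.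
    by rewrite toward_cellE ?leq_pmull //; have [] := toward_bounds c0 q (Q e).
  case: (fadj a c vac) => [->|->|<-]; first by rewrite leq_addr.
    by have [] := pb (f (rcons a c)).
  by have [] := pb (f a).
rewrite /pt; have := ghit (phi a) e (phin a va).
have := ghit (phi (rcons a c)) e (phin _ vac).
move: (nat_of_ord (g (phi a) e)) (nat_of_ord (g (phi (rcons a c)) e)) close => x y [xy yx].
move: (U _ _ _) (U _ _ _) => v u /andP[v1 v2] /andP[u1 u2].
(* Cell indices at most [q] apart allow coordinates [q + 1] cell widths apart, as a cell itself has
   width [1 / K]. *)
have cmp x' y' : (x' <= y' + q)%N -> x'.+1%:R / K%:R <= y'%:R / K%:R + q.+1%:R / K%:R :> R.
  by move=> xy'; rewrite -mulrDl ler_pM2r ?invr_gt0 // -natrD ler_nat addnS ltnS.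
have := cmp _ _ xy; have := cmp _ _ yx.
by rewrite ler_norml; lra.
Qed.

(** Three bad events: a coordinate outside the half-open interval, two coinciding points, a block
    missing a cell. They range over indices below [N], which bounds the size of every tree in
    question, so one exceptional event serves all trees. *)
Lemma event_E_prob (R : realType) (d : nat) (dT : measure_display)
    (T : measurableType dT) (P : probability T R) (U : nat -> 'I_d -> T -> R)
    (r : R) (M h k L q B : nat) :
  let K := (2 * (L * q)).+1 in let N := (2 ^ (h + h * h))%N in
  iid_uniform_points P U -> (0 < d)%N -> (0 < k)%N -> (0 < B)%N ->
  h = (k + L + k)%N -> (M <= h)%N ->
  (forall n, (2 ^ h <= n)%N ->
     (2 * L.+1 * (K ^ d).+1 * n <= 2 ^ k * (n %/ B))%N) ->
  Num.sqrt d%:R * (q.+1%:R / K%:R) <= r ->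
  ((1 - (N * K ^ d)%:R * (1 - (K ^ d)%:R^-1) ^+ B)%:E <= P (event_E U r M h))%E.
Proof.
move=> K N iidU d0 k0 B0 hE Mh num rK.
pose c0 : 'I_d := Ordinal d0.
pose cells := enum {ffun 'I_d -> 'I_K}.
have mhit Q i : measurable (hit U K Q i) by exact: measurable_hit iidU _ _ _.
have mO i c : measurable (outside U i c).
  by apply: measurableC; apply: (measurable_preim iidU); exact: measurable_itv.
have mS i j c : measurable (same_coord U i j c) by exact: measurable_same_coord iidU _ _ _.
pose AO (x : nat * 'I_d) := outside U x.1 x.2.
(* Equal points share the coordinate [c0], so one null event per pair suffices; the diagonal, where
   equality is trivial, is left out. *)
pose AS (x : nat * nat) := if x.1 == x.2 then set0 else same_coord U x.1 x.2 c0.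
pose AM (x : nat * {ffun 'I_d -> 'I_K}) := \big[setI/setT]_(i <- iota (x.1 * B) B)
  ~` hit U K (fun c => nat_of_ord (x.2 c)) i.
pose BO := \big[setU/set0]_(x <- [seq (i, c) | i <- iota 0 N, c <- enum 'I_d]) AO x.
pose BS := \big[setU/set0]_(x <- [seq (i, j) | i <- iota 0 N, j <- iota 0 N]) AS x.
pose BM := \big[setU/set0]_(x <- [seq (j, Q) | j <- iota 0 N, Q <- cells]) AM x.
have mAO x : measurable (AO x) by exact: mO.
have mAS x : measurable (AS x) by rewrite /AS; case: ifP.
have mAM x : measurable (AM x).
  by apply: bigsetI_measurable => i _; apply: measurableC; exact: mhit.
have mBO : measurable BO by exact: bigsetU_measurable.
have mBS : measurable BS by exact: bigsetU_measurable.
have mBM : measurable BM by exact: bigsetU_measurable.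
have PBO : (P BO <= 0)%E.
  apply: le_trans (measure_bigU_le _ (e := 0) mAO _) _; last by rewrite mulr0.
  by move=> x; rewrite /AO (outside_prob iidU).
have PBS : (P BS <= 0)%E.
  apply: le_trans (measure_bigU_le _ (e := 0) mAS _) _; last by rewrite mulr0.
  move=> x; rewrite /AS; case: ifP => [_|/negbT ij]; first by rewrite measure0.
  by rewrite (same_coord_prob iidU).
have PBM : (P BM <= ((N * K ^ d)%:R * (1 - (K ^ d)%:R^-1) ^+ B)%:E)%E.
  apply: le_trans (measure_bigU_le _ (e := (1 - (K ^ d)%:R^-1) ^+ B) mAM _) _.
    by move=> x; rewrite /AM (miss_prob iidU) ?iota_uniq // size_iota.
  by rewrite size_allpairs size_iota -cardE card_ffun !card_ord.
apply: (@prob_ge_compl _ _ _ _ _ (BO `|` (BS `|` BM))).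
- by apply: measurable_event_E; [exact: iidU.1|exact: mS].
- by apply: measurableU => //; exact: measurableU.
- move=> w /not_orP[]; rewrite /BO -bigcup_seq => nO /not_orP[].
  rewrite /BS /BM -!bigcup_seq => nS nM s /andP[/eqP sh /allP sM].
  have s2 : all (fun x => 2 <= x)%N s by apply/allP => x /sM /andP[].
  have n_ge : (2 ^ h <= bt_size s)%N by rewrite -sh; exact: bt_size_ge.
  have n_le : (bt_size s <= N)%N.
    apply: bt_size_le => //; apply/allP => x /sM /andP[_ xM]; exact: leq_trans Mh.
  apply: (@contains_bt_grid _ _ _ _ _ _ _ k L q B) => //.
  + by rewrite sh.
  + exact: num.
  + move=> i c isz; apply: contrapT => /negP out; apply: nO; exists (i, c) => /=.
      by apply/allpairsP; exists (i, c); rewrite mem_iota mem_enum /= (leq_trans isz).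
    by rewrite /AO /outside /= in_itv /=; exact/negP.
  + move=> i j isz jsz ij ptE; apply: nS; exists (i, j) => /=.
      by apply/allpairsP; exists (i, j); rewrite !mem_iota /= !(leq_trans _ n_le).
    by rewrite /AS /=; case: eqP => // _; exact: (congr1 (fun f => f c0) ptE).
  + move=> Q j jn; apply: contrapT => noi; apply: nM; exists (j, Q) => /=.
      apply/allpairsP; exists (j, Q); rewrite mem_iota mem_enum /= (leq_trans jn) //.
      by rewrite (leq_trans (leq_div _ _)).
    rewrite /AM -bigcap_seq => i /=; rewrite mem_iota => iB hi.
    by apply: noi; exists i.
- apply: (@le_trans _ _ (P BO + (P BS + P BM))%E).
    apply: (@le_trans _ _ (P BO + P (BS `|` BM))%E).
      by apply: measureU2 => //; exact: measurableU.
    by rewrite leeD2l //; exact: measureU2.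
  rewrite -[leRHS]add0e; apply: leeD => //.
  by rewrite -[leRHS]add0e; exact: leeD.
Qed.

(** As [k] is about a fixed fraction of [h], [2 ^ k] outgrows the number [m] of cells and the block
    length [B], both polynomial in [h]. *)
Lemma grid_parameters (d p : nat) : (2 < p)%N -> exists h0, forall h, (h0 <= h)%N ->
  let k := (h %/ p)%N in let L := (h - 2 * k)%N in
  let m := ((2 * (L * p)).+1 ^ d)%N in let B := (m * (3 * (h * h)))%N in
  [/\ (1 < h)%N, (0 < k)%N /\ (0 < B)%N, h = (k + L + k)%N, (m <= 2 ^ h)%N &
    forall n, (2 ^ h <= n)%N -> (2 * L.+1 * m.+1 * n <= 2 ^ k * (n %/ B))%N].
Proof.
move=> p2.
(* The quantity to beat is at most [(4 h) (2 m) (2 B) = 48 h^3 m^2], where [B = 3 m h^2]. The bounds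
   [h <= p * k.+1] and [3 p^2 k.+1] for the side of the grid give degree [3 + 2 d] in [k.+1]. *)
have [k0 Hk0] := poly_le_exp2 (48 * (p ^ 3 * (3 * (p * p)) ^ (2 * d))) (3 + 2 * d).
have p0 : (0 < p)%N by exact: ltnW (ltnW p2).
exists (p * k0.+1)%N => h hh k L.
have kk : (k0.+1 <= k)%N by rewrite /k leq_divRL // mulnC.
have kp : (k * p <= h)%N by exact: leq_divM.
have hp : (h < k.+1 * p)%N by exact: ltn_ceil.
clearbody k; clear hh.
have h1 : (1 < h)%N by clear -kk kp p2; nia.
have k2h : (2 * k <= h)%N by clear -kp p2; nia.
have hE : h = (k + L + k)%N by rewrite /L; clear -k2h; lia.
have Lh : (L <= h)%N by exact: leq_subr.
have hpk : (h <= p * k.+1)%N by rewrite mulnC ltnW.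
clearbody L => m B.
have m0 : (0 < m)%N by rewrite expn_gt0.
have hh0 : (0 < 3 * (h * h))%N by rewrite !muln_gt0 /= (ltnW h1).
have B0 : (0 < B)%N by rewrite /B muln_gt0 m0.
have KE : ((2 * (L * p)).+1 <= 3 * (p * p) * k.+1)%N.
  apply: (@leq_trans (3 * (h * p))%N).
    have : (L * p <= h * p)%N by rewrite leq_mul2r Lh orbT.
    have : (0 < h * p)%N by rewrite muln_gt0 p0 (ltnW h1).
    clear; lia.
  by rewrite -!mulnA leq_mul2l /= mulnC leq_mul2l hpk orbT.
have m2 : (m * m <= (3 * (p * p) * k.+1) ^ (2 * d))%N.
  have m1 : (m <= (3 * (p * p) * k.+1) ^ d)%N.
    by rewrite /m; case: (posnP d) => [->|d0] //; rewrite leq_exp2r.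
  by rewrite mul2n -addnn expnD leq_mul.
have h3 : (h * (h * h) <= p ^ 3 * k.+1 ^ 3)%N.
  by rewrite -expnMn !expnS expn0 muln1 !leq_mul.
have BE : B = (m * (3 * (h * h)))%N by [].
clearbody B m.
have key : (2 * L.+1 * m.+1 * (2 * B) <= 2 ^ k)%N.
  apply: leq_trans (Hk0 k (ltnW kk)).
  apply: (@leq_trans (48 * ((h * (h * h)) * (m * m)))%N).
    apply: (@leq_trans ((2 * (2 * h)) * (2 * m) * (2 * B))%N).
      have Lh2 : (L.+1 <= 2 * h)%N by clear -Lh h1; lia.
      have m2m : (m.+1 <= 2 * m)%N by clear -m0; lia.
      by rewrite leq_mul2r !leq_mul ?orbT.
    by apply: eq_leq; rewrite BE; ring.
  apply: (@leq_trans (48 * ((p ^ 3 * k.+1 ^ 3) * (3 * (p * p) * k.+1) ^ (2 * d)))%N).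
    by rewrite leq_mul2l leq_mul.
  by apply: eq_leq; rewrite expnMn expnD; ring.
have Bk : (B <= 2 ^ k)%N.
  apply: leq_trans key; rewrite mulnA leq_pmull //.
have kh : (2 ^ k <= 2 ^ h)%N by rewrite leq_exp2l // hE leq_addl.
split=> //; first by split=> //; exact: leq_trans kk.
  by apply: leq_trans kh; apply: leq_trans Bk; rewrite BE leq_pmulr.
move=> n hn; have nB : (0 < n %/ B)%N.
  by rewrite divn_gt0 //; apply: leq_trans hn; exact: leq_trans kh.
(* As [B <= n], the floor costs at most a factor 2. *)
have nle : (n <= 2 * B * (n %/ B))%N.
  apply: (@leq_trans ((n %/ B).+1 * B)%N); first by rewrite ltnW // ltn_ceil.
  by rewrite mulnAC leq_mul2r; apply/orP; right; clear -nB; lia.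
apply: (@leq_trans (2 * L.+1 * m.+1 * (2 * B * (n %/ B)))%N).
  by rewrite leq_mul2l nle orbT.
by rewrite mulnA leq_mul2r key orbT.
Qed.

(** By [exp_miss_le] a block misses a cell with probability at most [2 ^ - (3 h^2)], against at most
    [2 ^ (h^2 + 2 h)] pairs of block and cell. Since [3 h^2 >= h^2 + 3 h] for [h >= 2], a factor
    [2 ^ - h] remains. *)
Lemma miss_error_le (R : realType) (h m : nat) : (1 < h)%N -> (0 < m)%N ->
  (m <= 2 ^ h)%N ->
  (2 ^ (h + h * h) * m)%:R * (1 - m%:R^-1) ^+ (m * (3 * (h * h))) <= (2^-1 : R) ^+ h.
Proof.
move=> h1 m0 mh.
apply: (@le_trans _ _ ((2 ^ (h + h * h) * 2 ^ h)%:R * (2^-1 : R) ^+ (h + h * h + h + h))).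
  apply: ler_pM; rewrite ?ler0n //.
  - by rewrite exprn_ge0 // subr_ge0 invf_le1 ?ltr0n // ler1n.
  - by rewrite ler_nat leq_mul2l mh orbT.
  - apply: le_trans (exp_miss_le _ _ m0) _.
    by apply: ler_wiXn2l; [lra|lra|nia].
by rewrite -expnD exprD mulrA natrX exprVn mulfV ?mul1r //.
Qed.

(** Since [k / h <= 1 / p], it is enough that [(1 + 1/p) <= (1 - 2/p) (1 + eps)], which
    [eps > 8 / p] ensures. *)
Lemma grid_radius (R : realType) (eps : R) (d h k p : nat) : (0 < h)%N ->
  (k * p <= h)%N -> 8 < eps * p%:R -> 0 < eps < 1 ->
  Num.sqrt d%:R * (p.+1%:R / (2 * ((h - 2 * k) * p)).+1%:R) <=
  (1 + eps) * (Num.sqrt d%:R / (2 * h%:R)) :> R.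
Proof.
move=> h0 kp ep /andP[e0 e1].
have p8 : (8 < p)%N by rewrite -(ltr_nat R); have := ler0n R p; nra.
have H0 : 0 < h%:R :> R by rewrite ltr0n.
have -> : (1 + eps) * (Num.sqrt d%:R / (2 * h%:R)) =
   Num.sqrt d%:R * ((1 + eps) / (2 * h%:R)) by ring.
rewrite ler_wpM2l ?sqrtr_ge0 // ler_pdivrMr ?ltr0n // mulrAC ler_pdivlMr; last by lra.
have -> : (2 * ((h - 2 * k) * p)).+1%:R = 2 * ((h%:R - 2 * k%:R) * p%:R) + 1 :> R.
  by rewrite -natr1 !natrM natrB ?natrM //; clear -kp p8; nia.
have kp' : k%:R * p%:R <= h%:R :> R by rewrite -natrM ler_nat.
rewrite -natr1; nra.
Qed.

Theorem theorem3p1 (R : realType) (d : nat) (eps : R)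
  (M : nat -> nat) (r : nat -> R)
  (dT : measure_display) (Omega : measurableType dT) (P : probability Omega R)
  (U : nat -> 'I_d -> Omega -> R) :
  (0 < d)%N -> 0 < eps < 1 ->
  (forall h, (0 < h)%N -> (2 <= M h)%N) ->
  (fun h : nat => (M h)%:R * ln (h%:R : R) / h%:R) @ \oo --> (0 : R) ->
  (forall h, (0 < h)%N -> 0 < r h) ->
  iid_uniform_points P U ->
  let rstar := fun h : nat => Num.sqrt (d%:R : R) / (2 * h%:R) in
  ((forall h, (0 < h)%N -> r h <= (1 - eps) * rstar h) ->
     (fun h => P (event_F U (r h) (M h) h)) @ \oo --> 1%E) /\
  ((forall h, (0 < h)%N -> (1 + eps) * rstar h <= r h) ->
     (fun h => P (event_E U (r h) (M h) h)) @ \oo --> 1%E).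
Proof.
move=> d0 /andP[e0 e1] M2 Mo r0 iidU rstar.
have mS i j k : measurable [set w | U i k w = U j k w].
  exact: measurable_same_coord iidU _ _ _.
(* One fineness for both parts: [2 / p.+1 < eps] for the corner cells, and steps of [p] cells with
   [k = h %/ p] for [grid_radius]. *)
pose p := (Num.truncn (8 / eps)).+1.
have ep : 8 < eps * p%:R by rewrite mulrC -ltr_pdivrMr // truncnS_gt.
split=> rh.
  pose z : R := 1 - (p.+1 ^ d)%:R^-1.
  have z01 : `|z| < 1.
    have i0 : 0 < (p.+1 ^ d)%:R^-1 :> R by rewrite invr_gt0 ltr0n expn_gt0.
    have i1 : (p.+1 ^ d)%:R^-1 <= 1 :> R by rewrite invf_le1 ?ltr0n ?ler1n expn_gt0.
    by rewrite ger0_norm /z; lra.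
  apply: (@prob_cvg1 _ _ _ _ _ (fun h => 2 * z ^+ h)).
  - by move=> h; apply: measurable_event_F => //; exact: iidU.1.
  - near=> h; have h0 : (0 < h)%N by near: h; exact: nbhs_infty_gt.
    apply: event_F_prob (rh h h0) _ => //; first exact/ltW/r0.
    by rewrite ltr_pdivrMr ?ltr0n // -natr1; nra.
  - exact: cvg_geometric.
apply: (@prob_cvg1 _ _ _ _ _ (fun h => 1 * (2^-1) ^+ h)).
- by move=> h; apply: measurable_event_E => //; exact: iidU.1.
- have p2 : (2 < p)%N by rewrite -(ltr_nat R); nra.
  have [h0 Hh0] := grid_parameters d p2.
  have ln2 : 0 < ln 2 :> R by rewrite ln_gt0 // ltr1n.
  have Mlt : \forall h \near \oo, `|(M h)%:R * ln (h%:R : R) / h%:R| < ln 2.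
    exact: cvgr0_norm_lt.
  near=> h; have hh : (h0 <= h)%N by near: h; exact: nbhs_infty_ge.
  have [h1 [k0 B0] hE mh num] := Hh0 h hh.
  have hpos : (0 < h)%N by exact: ltnW.
  (* If [M h > h], then [M h * ln h / h] would be at least [ln h >= ln 2], against the growth
     condition. *)
  have Mh : (M h <= h)%N.
    have H0 : 0 < h%:R :> R by rewrite ltr0n.
    have lnh : ln 2 <= ln h%:R :> R by rewrite ler_ln ?posrE // ler_nat.
    have : (M h)%:R * ln h%:R / h%:R < ln 2 :> R.
      by apply: le_lt_trans (ler_norm _) _; near: h.
    rewrite ltr_pdivrMr // -(ler_nat R) => lt2; rewrite leNgt; apply/negP => hM.
    have M0 : 0 <= (M h)%:R :> R by rewrite ler0n.
    nra.
  apply: le_trans (event_E_prob iidU d0 k0 B0 hE Mh num _); last first.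
    by apply: le_trans (rh h hpos); apply: grid_radius => //; rewrite ?leq_divM ?e0.
  rewrite lee_fin mul1r lerD2l lerN2.
  by apply: miss_error_le => //; rewrite expn_gt0.
- by apply: cvg_geometric; rewrite ger0_norm; lra.
Unshelve. all: by end_near. Qed.
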